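(* Let $A,B_1,\dots,B_m\in\mathbb M_n(\mathbb C)$ be positive semidefinite and let $Z_1,\dots,Z_m\in\mathbb M_n(\mathbb C)$ be arbitrary. Then the limit $$\lim_{p\to\infty}\left(A^p\left\{\sum_{k=1}^m Z_k^*B_k^pZ_k\right\}A^p\right)^{1/p}$$ exists in norm.
   Context: $\mathbb M_n(\mathbb C)$ is the algebra of complex $n\times n$ matrices. Here $p$ ranges over positive real numbers; for positive semidefinite $T$ and $s>0$, $T^s$ is the positive semidefinite power defined by functional calculus. Convergence is in the operator norm. *)

(* Defs.v *)
From mathcomp Require Import all_boot all_order all_algebra.
From mathcomp Require Import complex.
From mathcomp Require Import all_classical all_reals all_analysis.

Set Implicit Arguments.
Unset Strict Implicit.
Unset Printing Implicit Defensive.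

Import Order.TTheory GRing.Theory Num.Theory.
Import numFieldNormedType.Exports.

Local Open Scope classical_set_scope.
Local Open Scope ring_scope.
Local Open Scope complex_scope.
Local Open Scope sesquilinear_scope.

Definition possemidef (R : realType) (n : nat) (A : 'M[R[i]]_n) : Prop :=
  A ^t* = A /\ forall x : 'cV[R[i]]_n, 0 <= (x ^t* *m A *m x) 0 0.

(* For a Hermitian T, [spectralmx T] is unitary, [spectral_diag T] is a real row
   vector, and T = P^-1 *m diag_mx (spectral_diag T) *m P with
   P = spectralmx T; [Re] only recasts the eigenvalues as elements of R.
   The value is meaningless when T is not Hermitian. *)
Definition funcalc (R : realType) (n : nat) (f : R -> R) (T : 'M[R[i]]_n) :
    'M[R[i]]_n :=
  invmx (spectralmx T)
    *m diag_mx (map_mx (fun z : R[i] => (f (complex.Re z))%:C)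
                       (spectral_diag T))
    *m spectralmx T.

(* The powers used here have s > 0, for which 0 `^ s = 0. *)
Definition powmx (R : realType) (n : nat) (T : 'M[R[i]]_n) (s : R) :
    'M[R[i]]_n :=
  funcalc (fun x : R => x `^ s) T.

Definition l2norm (R : realType) (n : nat) (x : 'cV[R[i]]_n) : R :=
  Num.sqrt (\sum_(i < n) ComplexField.Normc.normc (x i 0) ^+ 2).

Definition opnorm (R : realType) (n : nat) (M : 'M[R[i]]_n) : R :=
  sup [set l2norm (M *m x) | x in [set x : 'cV[R[i]]_n | l2norm x <= 1]].

(* Main.v *)
(** The entries of G_p = A^p (sum_k Z_k^* B_k^p Z_k) A^p are finite sums of
    terms c e^{theta p}. For fixed t > 0 the resolvent G_p (G_p + t^p)^-1 has,
    by Cramer's rule, entries that are quotients of such sums; they are bounded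
    because the spectrum lies in [0, 1], and a bounded quotient of exponential
    sums converges as p -> oo. Since x^p / (x^p + t^p) tends to the indicator
    of t < x, the Riemann sum d * sum_j x^p / (x^p + (j d)^p) approximates x to
    within 3d once p is large, uniformly on bounded sets. Taking x = G_p^{1/p},
    whose norm is bounded through the trace of G_p, shows that the entries of
    G_p^{1/p} are Cauchy. *)

Require Import Defs.
From mathcomp Require Import all_boot all_order all_algebra.
From mathcomp Require Import complex.
From mathcomp Require Import all_classical all_reals all_analysis.
From mathcomp Require Import ring lra.

Import Order.TTheory GRing.Theory Num.Theory.
Import numFieldNormedType.Exports.

Local Open Scope classical_set_scope.
Local Open Scope ring_scope.
Local Open Scope complex_scope.
Local Open Scope sesquilinear_scope.

(** * Real exponential sums and limits of their quotients *)

Definition exppoly {R : realType} (f : R -> R) : Prop :=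
  exists s : seq (R * R),
    forall p, 0 < p -> f p = \sum_(tc <- s) tc.2 * expR (tc.1 * p).

Section ExpPoly.
Context {R : realType}.
Implicit Types (f g : R -> R) (s : seq (R * R)).

Lemma eq_exppoly f g :
  (forall p, 0 < p -> f p = g p) -> exppoly f -> exppoly g.
Proof. by move=> fg [s fE]; exists s => p p0; rewrite -fg// fE. Qed.

Lemma exppoly_cst (c : R) : exppoly (fun=> c).
Proof.
by exists [:: (0, c)] => p _; rewrite big_seq1/= mul0r expR0 mulr1.
Qed.

Lemma exppoly_expR (t : R) : exppoly (fun p => expR (t * p)).
Proof. by exists [:: (t, 1)] => p _; rewrite big_seq1/= mul1r. Qed.

Lemma exppolyD f g : exppoly f -> exppoly g -> exppoly (fun p => f p + g p).
Proof.
by move=> [s fE] [t gE]; exists (s ++ t) => p p0; rewrite big_cat fE// gE.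
Qed.

Lemma exppolyM f g : exppoly f -> exppoly g -> exppoly (fun p => f p * g p).
Proof.
move=> [s fE] [t gE].
exists [seq (a.1 + b.1, a.2 * b.2) | a <- s, b <- t] => p p0.
rewrite fE// gE// big_allpairs_dep mulr_suml; apply: eq_bigr => a _.
rewrite mulr_sumr; apply: eq_bigr => b _ /=.
by rewrite mulrDl expRD mulrACA.
Qed.

Lemma exppolyN f : exppoly f -> exppoly (fun p => - f p).
Proof.
move=> /(exppolyM _ _ (exppoly_cst (-1))); apply: eq_exppoly => p _.
by rewrite mulN1r.
Qed.

Lemma exppoly_powR (a : R) : 0 <= a -> exppoly (fun p => a `^ p).
Proof.
rewrite le_eqVlt => /orP[/eqP<-|a0].
  apply: eq_exppoly (exppoly_cst 0) => p p0.
  by rewrite powR0// gt_eqF.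
apply: eq_exppoly (exppoly_expR (ln a)) => p _.
by rewrite /powR gt_eqF// mulrC.
Qed.

(** The sum of the absolute values of the exponents dominates each of them, which avoids choosing a
    maximum. The bound is later applied to the trace of G_p. *)
Lemma exppoly_bound f : exppoly f ->
  exists C t : R, 0 <= C /\ forall p, 0 < p -> `|f p| <= C * expR (t * p).
Proof.
move=> [s fE].
exists (\sum_(tc <- s) `|tc.2|), (\sum_(tc <- s) `|tc.1|).
split; [exact: sumr_ge0|move=> p p0].
rewrite fE// mulr_suml; apply: le_trans (ler_norm_sum _ _ _) _.
rewrite big_seq [leRHS]big_seq; apply: ler_sum => tc tcs.
rewrite normrM (ger0_norm (expR_ge0 _)) ler_wpM2l// ler_expR ler_pM2r//.
rewrite (le_trans (ler_norm _))// (big_rem tc)//= lerDl; exact: sumr_ge0.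
Qed.

Lemma eq_cvgr_pinfty f g (l : R) : (forall p, 0 < p -> g p = f p) ->
  g p @[p --> +oo] --> l -> f p @[p --> +oo] --> l.
Proof.
move=> gf; apply: cvg_trans; apply: near_eq_cvg; near=> p.
by apply: gf; near: p; exact: nbhs_pinfty_gt.
Unshelve. all: by end_near. Qed.

Lemma cvgr_expR_neg (t : R) : t < 0 -> expR (t * p) @[p --> +oo] --> (0 : R).
Proof.
move=> t0.
have -> : (fun p => expR (t * p)) = (fun x => expR (- x)) \o (fun p => p * (- t)).
  by apply/funext => p /=; congr expR; ring.
apply: (cvg_comp (fun p => p * (- t)) _ _ (@cvgr_expR R)).
apply/cvgryPge => A; near=> p.
rewrite -ler_pdivrMr ?oppr_gt0//; near: p; exact: nbhs_pinfty_ge.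
Unshelve. all: by end_near. Qed.

Lemma expsum_cvg s : (forall tc, tc \in s -> tc.1 < 0) ->
  \sum_(tc <- s) tc.2 * expR (tc.1 * p) @[p --> +oo] --> (0 : R).
Proof.
elim: s => [|tc s IH] h.
  by apply: (@eq_cvgr_pinfty _ (fun=> 0)) => [p _|]; [rewrite big_nil|exact: cvg_cst].
apply: (@eq_cvgr_pinfty _
    (fun p => tc.2 * expR (tc.1 * p) + \sum_(x <- s) x.2 * expR (x.1 * p))).
  by move=> p _; rewrite big_cons.
rewrite -[X in _ @ _ --> X](addr0 0); apply: cvgD; last first.
  by apply: IH => x xs; apply: h; rewrite inE xs orbT.
rewrite -[X in _ @ _ --> X](mulr0 tc.2); apply: cvgZr; apply: cvgr_expR_neg.
by apply: h; rewrite mem_head.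
Qed.

(** Induction on the number of terms: the terms of maximal exponent are collected into one
    coefficient, which is the limit sought unless it vanishes. *)
Lemma exppoly_leading f : exppoly f ->
  (forall p, 0 < p -> f p = 0) \/
  exists mu c : R, c != 0 /\ f p * expR (- mu * p) @[p --> +oo] --> c.
Proof.
move=> [s]; have [k] := ubnP (size s); elim: k f s => // k IH f s sk fE.
case: (pselect (exists tc, tc \in s)) => [[tc0 tc0s]|none]; last first.
  left=> p p0; rewrite fE// big_seq big1// => tc tcs.
  by case: none; exists tc.
have [tcm tcms muP] : exists2 tcm, tcm \in s & forall tc, tc \in s -> tc.1 <= tcm.1.
  elim: (s) tc0 tc0s => // a s' IHs tc0 _.
  case: (pselect (exists tc, tc \in s')) => [[b bs]|none].
    have [m ms mP] := IHs _ bs.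
    have [am|ma] := leP a.1 m.1.
      exists m; first by rewrite inE ms orbT.
      by move=> tc; rewrite inE => /orP[/eqP->//|/mP].
    exists a; first exact: mem_head.
    move=> tc; rewrite inE => /orP[/eqP->//|/mP h].
    exact: le_trans h (ltW ma).
  exists a; first exact: mem_head.
  by move=> tc; rewrite inE => /orP[/eqP->//|h]; case: none; exists tc.
pose c := \sum_(tc <- s | tc.1 == tcm.1) tc.2.
pose s' := [seq tc <- s | tc.1 != tcm.1].
have fE' p : 0 < p -> f p = c * expR (tcm.1 * p) + \sum_(tc <- s') tc.2 * expR (tc.1 * p).
  move=> p0; rewrite fE// (bigID (fun tc => tc.1 == tcm.1))/= big_filter.
  by congr +%R; rewrite mulr_suml; apply: eq_bigr => tc /eqP->.
(* If the terms of maximal exponent cancel, they can be dropped. *)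
have [c0|c0] := eqVneq c 0.
  apply: (IH f s').
    rewrite -ltnS (leq_trans _ sk)// ltnS size_filter.
    rewrite -(count_predC (fun tc => tc.1 == tcm.1)) -[X in (X < _)%N]add0n.
    by rewrite ltn_add2r -has_count; apply/hasP; exists tcm.
  by move=> p p0; rewrite fE'// c0 mul0r add0r.
right; exists tcm.1, c; split=> //.
(* After division by the leading exponential, all remaining exponents are negative. *)
have h : c + \sum_(tc <- [seq (tc.1 - tcm.1, tc.2) | tc <- s']) tc.2 * expR (tc.1 * p)
    @[p --> +oo] --> c.
  rewrite -[X in _ @ _ --> X]addr0; apply: cvgD; first exact: cvg_cst.
  apply: expsum_cvg => tc /mapP[x]; rewrite mem_filter => /andP[xm xs] -> /=.
  by rewrite subr_lt0 lt_neqAle xm muP.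
apply: eq_cvgr_pinfty h => p p0; rewrite fE'//.
rewrite mulrDl -mulrA -expRD mulNr subrr expR0 mulr1; congr +%R.
rewrite big_map mulr_suml; apply: eq_bigr => tc _ /=.
by rewrite -mulrA -expRD -mulrBl.
Qed.

(** By the leading terms, f / g behaves like (c / d) e^{(mu - nu) p}; boundedness excludes mu > nu,
    and otherwise this has a finite limit. *)
Lemma exppoly_ratio_cvg f g (M : R) : exppoly f -> exppoly g ->
  (forall p, 0 < p -> g p != 0) -> (forall p, 0 < p -> `|f p / g p| <= M) ->
  cvg (f p / g p @[p --> +oo]).
Proof.
move=> /exppoly_leading Ef /exppoly_leading Eg g0 fgM.
case: Eg => [gz|[nu [d [d0 gd]]]].
  by have := g0 _ ltr01; rewrite gz ?eqxx.
case: Ef => [fz|[mu [c [c0 fc]]]].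
  apply: (cvgP (0 : R)); apply: (@eq_cvgr_pinfty _ (fun=> 0)) => [p p0|].
    by rewrite fz ?mul0r.
  exact: cvg_cst.
have fg : f p * expR (- mu * p) / (g p * expR (- nu * p)) @[p --> +oo] --> c / d.
  by apply: cvgM => //; apply: cvgV.
have fgE p : f p / g p =
    f p * expR (- mu * p) / (g p * expR (- nu * p)) * expR ((mu - nu) * p).
  have -> : (mu - nu) * p = mu * p - nu * p by ring.
  rewrite !expRD !mulNr !expRN invfM.
  have /lt0r_neq0 h1 := expR_gt0 (mu * p).
  have /lt0r_neq0 h2 := expR_gt0 (nu * p).
  rewrite [RHS](_ : _ = f p * (g p)^-1 * ((expR (mu * p))^-1 * expR (mu * p)) *
    ((expR (nu * p))^-1^-1 / expR (nu * p))); last by ring.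
  by rewrite mulVf// invrK divff// !mulr1.
have [munu|numu|munu] := ltgtP mu nu; last first.
- apply: (cvgP (c / d)); apply: eq_cvgr_pinfty fg => p _.
  by rewrite [RHS]fgE munu subrr mul0r expR0 mulr1.
(* If nu < mu, the rescaled quotient tends to c / d, which is non-zero, but also to 0 because f / g
   is bounded by M. *)
- have h : f p / g p * expR ((nu - mu) * p) @[p --> +oo] --> c / d.
    apply: eq_cvgr_pinfty fg => p _.
    rewrite fgE -[RHS]mulrA -expRD -mulrDl.
    by rewrite (_ : mu - nu + (nu - mu) = 0) ?mul0r ?expR0 ?mulr1//; ring.
  have h0 : f p / g p * expR ((nu - mu) * p) @[p --> +oo] --> (0 : R).
    apply/norm_cvg0P.
    have hM : M * expR ((nu - mu) * p) @[p --> +oo] --> (0 : R).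
      rewrite -[X in _ @ _ --> X](mulr0 M); apply: cvgZr; apply: cvgr_expR_neg.
      by rewrite subr_lt0.
    apply: (squeeze_cvgr _ (@cvg_cst _ _ _ _ _) hM); near=> p.
    rewrite normr_ge0/= normrM (ger0_norm (expR_ge0 _)) ler_wpM2r ?expR_ge0//.
    by apply: fgM; near: p; exact: nbhs_pinfty_gt.
  have /eqP : c / d = 0 by apply: (cvg_unique _ h h0).
  rewrite mulf_eq0 invr_eq0.
  by rewrite (negbTE c0) (negbTE d0).
- apply: (cvgP (c / d * 0)).
  apply: (eq_cvgr_pinfty _ _ _ (fun p _ => esym (fgE p))).
  by apply: cvgM => //; apply: cvgr_expR_neg; rewrite subr_lt0.
Unshelve. all: by end_near. Qed.

End ExpPoly.

(** * Riemann-sum approximation of a number by quotients of powers *)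

Ltac minmax_lra :=
  rewrite !minEle; repeat (case: ifPn; rewrite -?ltNge => ?);
  rewrite !maxEle; repeat (case: ifPn; rewrite -?ltNge => ?); lra.

Section RootApproximation.
Context {R : realType}.
Implicit Types (d x y a b p lam : R) (N : nat).

(** The intervals from j d to (j+1) d tile the segment from 0 to N d, and each summand is the length
    of the part of its interval lying below y. *)
Lemma sum_clamp d N y : 0 <= d ->
  \sum_(j < N) Num.max 0 (Num.min d (y - j%:R * d)) =
  Num.max 0 (Num.min (N%:R * d) y).
Proof.
move=> d0; elim: N => [|N IH].
  rewrite big_ord0 mul0r; minmax_lra.
rewrite big_ord_recr/= IH -natr1 mulrDl mul1r.
have Nd0 : 0 <= N%:R * d by rewrite mulr_ge0.
move: (N%:R * d) Nd0 => M M0; minmax_lra.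
Qed.

(** Since d >= b / N, a gap of d gives a <= b (1 - 1/N) <= b e^{-1/N}; it remains to take p-th
    powers. *)
Lemma powR_ratio_le d N a b p : 0 < d -> (0 < N)%N -> 0 < p -> 0 <= a -> 0 < b ->
  b <= N%:R * d -> a <= b - d ->
  a `^ p / (a `^ p + b `^ p) <= expR (- N%:R^-1 * p).
Proof.
move=> d0 N0 p0 a0 b0 bN ab.
have N0' : 0 < N%:R :> R by rewrite ltr0n.
have bp : 0 < b `^ p by rewrite powR_gt0.
have ap : 0 <= a `^ p by rewrite powR_ge0.
rewrite ler_pdivrMr ?ltr_wpDl//.
have abe : a <= b * expR (- N%:R^-1).
  apply: le_trans (_ : b * (1 - N%:R^-1) <= _).
    rewrite mulrBr mulr1; have : b / N%:R <= d by rewrite ler_pdivrMr// mulrC.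
    lra.
  by rewrite ler_pM2l// expR_ge1Dx.
have : a `^ p <= (b * expR (- N%:R^-1)) `^ p.
  by apply: ge0_ler_powR => //; rewrite ?nnegrE ?mulr_ge0 ?expR_ge0// ltW.
rewrite powRM ?expR_ge0 ?(ltW b0)// -expRM => /le_trans; apply.
by rewrite mulrC ler_wpM2l ?powR_ge0// lerDr.
Qed.

(* The j-th summand is nearly the indicator of ((j+1) d <= x), so d times the
   sum is squeezed between the clamped lengths of x - 2d and x + d. *)
Lemma powR_root_approx d N p x : 0 < d -> (0 < N)%N -> 0 < p ->
  expR (- N%:R^-1 * p) <= N%:R^-1 -> 0 <= x -> x <= N%:R * d ->
  `|x - d * \sum_(j < N) (x `^ p / (x `^ p + (j.+1%:R * d) `^ p))| <= 3 * d.
Proof.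
move=> d0 N0 p0 pN x0 xN.
have N0' : 0 < N%:R :> R by rewrite ltr0n.
have xp : 0 <= x `^ p by rewrite powR_ge0.
have tp (j : 'I_N) : 0 < (j.+1%:R * d) `^ p by rewrite powR_gt0// mulr_gt0.
have tN (j : 'I_N) : j.+1%:R * d <= N%:R * d.
  by rewrite ler_wpM2r ?ler_nat// ltW.
have t0 (j : 'I_N) : 0 < j.+1%:R * d by rewrite mulr_gt0.
have tE (j : 'I_N) : j.+1%:R * d = j%:R * d + d by rewrite -natr1 mulrDl mul1r.
have sumd : \sum_(j < N) (d / N%:R) = d.
  by rewrite sumr_const card_ord -[LHS]mulr_natr mulfVK// gt_eqF.
have f1 (j : 'I_N) : x `^ p / (x `^ p + (j.+1%:R * d) `^ p) <= 1.
  by rewrite ler_pdivrMr ?ltr_wpDl// mul1r lerDl ltW.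
have f0 (j : 'I_N) : 0 <= x `^ p / (x `^ p + (j.+1%:R * d) `^ p).
  by rewrite divr_ge0// addr_ge0// ltW.
have dN0 : 0 <= d / N%:R by rewrite divr_ge0// ltW.
rewrite mulr_sumr ler_norml; apply/andP; split.
  (* When j d > x, the threshold (j+1) d exceeds x by at least d, so the quotient is at most 1/N.
     These errors add up to at most d. *)
  have : \sum_(j < N) d * (x `^ p / (x `^ p + (j.+1%:R * d) `^ p)) <=
      \sum_(j < N) (Num.max 0 (Num.min d (x + d - j%:R * d)) + d / N%:R).
    apply: ler_sum => j _.
    have [xj|jx] := lerP (j%:R * d) x.
      rewrite min_l; last by lra.
      rewrite max_r ?(ltW d0)//.
      by apply: ler_wpDr => //; rewrite -[leRHS]mulr1 ler_pM2l.
    have : d * (x `^ p / (x `^ p + (j.+1%:R * d) `^ p)) <= d / N%:R.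
      rewrite ler_pM2l//; apply: le_trans pN; apply: (powR_ratio_le d) => //.
      by rewrite tE; lra.
    move=> /le_trans; apply; rewrite lerDr le_max lexx//.
  rewrite big_split/= sumd sum_clamp ?(ltW d0)//.
  minmax_lra.
(* When j d < x - 2d, the threshold lies at least d below x, so the complementary quotient is at
   most 1/N. The shift 2d plus the total error d gives the constant 3. *)
have : \sum_(j < N) (Num.max 0 (Num.min d (x - 2 * d - j%:R * d)) - d / N%:R) <=
    \sum_(j < N) d * (x `^ p / (x `^ p + (j.+1%:R * d) `^ p)).
  apply: ler_sum => j _.
  have [xj|jx] := lerP (x - 2 * d) (j%:R * d).
    have -> : Num.max 0 (Num.min d (x - 2 * d - j%:R * d)) = 0.
      by minmax_lra.
    by have := mulr_ge0 (ltW d0) (f0 j); lra.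
  have : (j.+1%:R * d) `^ p / ((j.+1%:R * d) `^ p + x `^ p) <= N%:R^-1.
    apply: le_trans pN; apply: (powR_ratio_le d) => //.
    - exact/ltW.
    - by have := t0 j; rewrite tE; lra.
    - by rewrite tE; lra.
  move=> /(ler_wpM2l (ltW d0)).
  have -> : d * ((j.+1%:R * d) `^ p / ((j.+1%:R * d) `^ p + x `^ p)) =
      d - d * (x `^ p / (x `^ p + (j.+1%:R * d) `^ p)).
    by have h := tp j; field; lra.
  have : Num.max 0 (Num.min d (x - 2 * d - j%:R * d)) <= d.
    by minmax_lra.
  lra.
rewrite sumrB sumd sum_clamp ?(ltW d0)//.
minmax_lra.
Qed.

End RootApproximation.

(** * Complex exponential sums, and matrices with such entries *)

(** The exponents stay real; splitting into two real sums lets the real quotient lemma act on each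
    part. *)
Definition cexppoly {R : realType} (f : R -> R[i]) : Prop :=
  exppoly (fun p => complex.Re (f p)) /\ exppoly (fun p => complex.Im (f p)).

Section ComplexExpPoly.
Context {R : realType}.
Implicit Types (f g : R -> R[i]).

Lemma eq_cexppoly f g :
  (forall p, 0 < p -> f p = g p) -> cexppoly f -> cexppoly g.
Proof.
by move=> fg [fr fi]; split; [apply: eq_exppoly fr|apply: eq_exppoly fi] => p p0;
  rewrite fg.
Qed.

Lemma cexppoly_real (u : R -> R) : exppoly u -> cexppoly (fun p => (u p)%:C).
Proof. by move=> Eu; split=> //=; exact: exppoly_cst. Qed.

Lemma cexppoly_cst (c : R[i]) : cexppoly (fun=> c).
Proof. by split; exact: exppoly_cst. Qed.

Lemma cexppolyD f g : cexppoly f -> cexppoly g -> cexppoly (fun p => f p + g p).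
Proof.
move=> [fr fi] [gr gi]; split; [have := exppolyD _ _ fr gr|have := exppolyD _ _ fi gi];
  by apply: eq_exppoly => p _; case: (f p) (g p) => [? ?] [].
Qed.

Lemma cexppolyM f g : cexppoly f -> cexppoly g -> cexppoly (fun p => f p * g p).
Proof.
move=> [fr fi] [gr gi]; split.
  have := exppolyD _ _ (exppolyM _ _ fr gr) (exppolyN _ (exppolyM _ _ fi gi)).
  by apply: eq_exppoly => p _; case: (f p) (g p) => [? ?] [].
have := exppolyD _ _ (exppolyM _ _ fr gi) (exppolyM _ _ fi gr).
by apply: eq_exppoly => p _; case: (f p) (g p) => [? ?] [].
Qed.

Lemma cexppoly_sum (I : Type) (r : seq I) (P : pred I) (F : I -> R -> R[i]) :
  (forall i, cexppoly (F i)) -> cexppoly (fun p => \sum_(i <- r | P i) F i p).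
Proof.
move=> EF; elim: r => [|i r IH].
  by apply: eq_cexppoly (cexppoly_cst 0) => p _; rewrite big_nil.
have [Pi|nPi] := boolP (P i).
  apply: eq_cexppoly (cexppolyD _ _ (EF i) IH) => p _.
  by rewrite big_cons Pi.
by apply: eq_cexppoly IH => p _; rewrite big_cons (negbTE nPi).
Qed.

Lemma cexppoly_prod (I : Type) (r : seq I) (F : I -> R -> R[i]) :
  (forall i, cexppoly (F i)) -> cexppoly (fun p => \prod_(i <- r) F i p).
Proof.
move=> EF; elim: r => [|i r IH].
  by apply: eq_cexppoly (cexppoly_cst 1) => p _; rewrite big_nil.
apply: eq_cexppoly (cexppolyM _ _ (EF i) IH) => p _.
by rewrite big_cons.
Qed.

Definition cexppoly_mx {m n} (G : R -> 'M[R[i]]_(m, n)) : Prop :=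
  forall i j, cexppoly (fun p => G p i j).

Lemma cexppoly_mx_cst m n (A : 'M[R[i]]_(m, n)) : cexppoly_mx (fun=> A).
Proof. by move=> i j; exact: cexppoly_cst. Qed.

Lemma cexppoly_mxD m n (G H : R -> 'M[R[i]]_(m, n)) :
  cexppoly_mx G -> cexppoly_mx H -> cexppoly_mx (fun p => G p + H p).
Proof.
move=> EG EH i j; apply: eq_cexppoly (cexppolyD _ _ (EG i j) (EH i j)) => p _.
by rewrite mxE.
Qed.

Lemma cexppoly_mx_sum m n k (G : 'I_k -> R -> 'M[R[i]]_(m, n)) :
  (forall l, cexppoly_mx (G l)) -> cexppoly_mx (fun p => \sum_(l < k) G l p).
Proof.
move=> EG i j.
apply: eq_cexppoly (cexppoly_sum _ (index_enum _) xpredT _ (fun l => EG l i j)) => p _.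
by rewrite summxE.
Qed.

Lemma cexppoly_mulmx m n k (G : R -> 'M[R[i]]_(m, n)) (H : R -> 'M[R[i]]_(n, k)) :
  cexppoly_mx G -> cexppoly_mx H -> cexppoly_mx (fun p => G p *m H p).
Proof.
move=> EG EH i j.
apply: eq_cexppoly (cexppoly_sum _ (index_enum _) xpredT _
  (fun l => cexppolyM _ _ (EG i l) (EH l j))) => p _.
by rewrite mxE.
Qed.

(** The Leibniz formula uses only finite sums and products. With the adjugate below, this keeps both
    sides of Cramer's quotient among exponential sums. *)
Lemma cexppoly_det n (G : R -> 'M[R[i]]_n) :
  cexppoly_mx G -> cexppoly (fun p => \det (G p)).
Proof.
move=> EG; rewrite /determinant; apply: cexppoly_sum => s.
apply: cexppolyM; first exact: cexppoly_cst.
by apply: cexppoly_prod => i; exact: EG.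
Qed.

Lemma cexppoly_adj n (G : R -> 'M[R[i]]_n) :
  cexppoly_mx G -> cexppoly_mx (fun p => \adj (G p)).
Proof.
move=> EG i j; rewrite /adjugate.
apply: (@eq_cexppoly (fun p => (-1) ^+ (j + i) * \det (row' j (col' i (G p))))).
  by move=> p _; rewrite mxE.
apply: cexppolyM; first exact: cexppoly_cst.
apply: cexppoly_det => k l.
by apply: eq_cexppoly (EG (lift j k) (lift i l)) => p _; rewrite !mxE.
Qed.

End ComplexExpPoly.

(** * Spectral calculus and positive semidefinite matrices *)

Section SpectralCalculus.
Context {C : numClosedFieldType} {n : nat}.
Implicit Types (A T : 'M[C]_n) (f g : C -> C) (d e : 'rV[C]_n).

(** Over [R[i]] this is convertible to [possemidef], so the facts below apply to it directly. *)
Definition psdmx {m} (A : 'M[C]_m) : Prop :=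
  A ^t* = A /\ forall x : 'cV[C]_m, 0 <= (x ^t* *m A *m x) 0 0.

(** Functions of a complex argument allow A itself to be the value at [id]; [funcalc] is an instance
    by conversion. *)
Definition spectral_calc f T : 'M[C]_n :=
  invmx (spectralmx T) *m diag_mx (map_mx f (spectral_diag T)) *m spectralmx T.

(** The (i, j) entry of the rank-one orthogonal projection onto the k-th eigenvector. *)
Definition spectral_weight T (i j k : 'I_n) : C :=
  (spectralmx T k i)^* * spectralmx T k j.

Lemma spectral_calcE f T i j :
  spectral_calc f T i j =
  \sum_k f (spectral_diag T 0 k) * spectral_weight T i j k.
Proof.
rewrite /spectral_calc invmx_unitary ?spectral_unitarymx// mxE.
apply: eq_bigr => k _; rewrite mul_mx_diag !mxE /spectral_weight.
by rewrite [X in X * _]mulrC mulrA.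
Qed.

(** Each row of a unitary matrix is a unit vector. *)
Lemma unitarymx_entry_le1 (U : 'M[C]_n) i j : U \is unitarymx -> `|U i j| <= 1.
Proof.
move=> /unitarymxP /matrixP /(_ i i); rewrite !mxE eqxx mulr1n => h.
rewrite -(@expr_le1 _ 2)// -h (bigD1 j)//= !mxE -normCK lerDl.
by apply: sumr_ge0 => k _; rewrite !mxE -normCK exprn_ge0.
Qed.

Lemma spectral_weight_le1 T i j k : `|spectral_weight T i j k| <= 1.
Proof.
have U := spectral_unitarymx T.
by rewrite normrM norm_conjC mulr_ile1// unitarymx_entry_le1.
Qed.

Lemma spectral_calcM f g T :
  spectral_calc f T *m spectral_calc g T = spectral_calc (fun x => f x * g x) T.
Proof.
rewrite /spectral_calc.
move: (spectral_diag T) (spectralmx T) (spectral_unit T) => d P Pu.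
rewrite !mulmxA mulmxK// -[_ *m diag_mx (map_mx g d)]mulmxA mulmx_diag.
by congr (_ *m diag_mx _ *m _); apply/rowP => k; rewrite !mxE.
Qed.

Lemma spectral_calcD f g T :
  spectral_calc f T + spectral_calc g T = spectral_calc (fun x => f x + g x) T.
Proof.
rewrite /spectral_calc -mulmxDl -mulmxDr -raddfD/=.
by congr (_ *m diag_mx _ *m _); apply/rowP => k; rewrite !mxE.
Qed.

Lemma spectral_calc_cst (c : C) T : spectral_calc (fun=> c) T = c%:M.
Proof.
rewrite /spectral_calc (_ : map_mx _ _ = const_mx c) ?diag_const_mx; last first.
  by apply/rowP => k; rewrite !mxE.
by rewrite mul_mx_scalar -scalemxAl mulVmx ?spectral_unit// scalemx1.
Qed.

Lemma eq_spectral_calc f g T :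
  (forall k, f (spectral_diag T 0 k) = g (spectral_diag T 0 k)) ->
  spectral_calc f T = spectral_calc g T.
Proof.
move=> fg; congr (_ *m diag_mx _ *m _).
by apply/rowP => k; rewrite !mxE fg.
Qed.

Lemma spectral_calc_id A : psdmx A -> spectral_calc id A = A.
Proof.
move=> [Ah _].
have /orthomx_spectralP AE : A \is normalmx by apply/normalmxP; rewrite Ah.
by rewrite [RHS]AE /spectral_calc map_mx_id.
Qed.

(** The eigenvalue is the value of the quadratic form at the k-th eigenvector, the k-th column of
    the adjoint of [spectralmx A]. *)
Lemma spectral_diag_ge0 A k : psdmx A -> 0 <= spectral_diag A 0 k.
Proof.
move=> [Ah Ap].
have /orthomx_spectralP AE : A \is normalmx by apply/normalmxP; rewrite Ah.
have U := spectral_unitarymx A.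
move: AE (Ap (col k (spectralmx A ^t*))) => AE.
rewrite {2}AE invmx_unitary//.
move: (spectral_diag A) (spectralmx A) U => d P /unitarymxP U.
rewrite tr_col map_row trmxCK.
have -> (M : 'M[C]_n) : (row k P *m M *m col k (P ^t*)) 0 0 = (P *m M *m P ^t*) k k.
  rewrite -row_mul [LHS]mxE [RHS]mxE; apply: eq_bigr => l _.
  by rewrite [row _ _ _ _]mxE [col _ _ _ _]mxE.
by rewrite !mulmxA U mul1mx -mulmxA U mulmx1 mxE eqxx mulr1n.
Qed.

Lemma det_spectral_calc f T :
  \det (spectral_calc f T) = \prod_k f (spectral_diag T 0 k).
Proof.
rewrite /spectral_calc !det_mulmx mulrAC -det_mulmx mulVmx ?spectral_unit// det1 mul1r.
by rewrite det_diag; apply: eq_bigr => k _; rewrite mxE.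
Qed.

Lemma tr_spectral_calc f T :
  \tr (spectral_calc f T) = \sum_k f (spectral_diag T 0 k).
Proof.
rewrite /spectral_calc -mulmxA mxtrace_mulC mulmxK ?spectral_unit// mxtrace_diag.
by apply: eq_bigr => k _; rewrite mxE.
Qed.

(** Unlike single eigenvalues, the trace of G_p is visibly an exponential sum, so this is how growth
    bounds reach the spectrum. *)
Lemma spectral_diag_le_tr A k : psdmx A -> spectral_diag A 0 k <= \tr A.
Proof.
move=> Ap; rewrite -{2}(spectral_calc_id _ Ap) tr_spectral_calc (bigD1 k)//= lerDl.
by apply: sumr_ge0 => l _; exact: spectral_diag_ge0.
Qed.

Lemma det_shift A (t : C) : psdmx A ->
  \det (A + t%:M) = \prod_k (spectral_diag A 0 k + t).
Proof.
move=> Ap; rewrite -{1}(spectral_calc_id _ Ap) -(spectral_calc_cst t A).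
by rewrite spectral_calcD det_spectral_calc.
Qed.

(** The left side is A (A + t)^-1, and Cramer's rule expands the inverse; A + t is invertible
    because its eigenvalues are positive. *)
Lemma spectral_calc_resolvent A (t : C) : psdmx A -> 0 < t ->
  spectral_calc (fun x => x / (x + t)) A =
  (\det (A + t%:M))^-1 *: (A *m \adj (A + t%:M)).
Proof.
move=> Ap t0.
have D0 k : spectral_diag A 0 k + t != 0.
  by rewrite gt_eqF// ltr_wpDl// spectral_diag_ge0.
have AtE : A + t%:M = spectral_calc (fun x => x + t) A.
  by rewrite -{1}(spectral_calc_id _ Ap) -(spectral_calc_cst t A) spectral_calcD.
have uAt : A + t%:M \in unitmx.
  by rewrite unitmxE unitfE det_shift//; apply/prodf_neq0.
rewrite scalemxAr -[_ *: \adj _](_ : invmx (A + t%:M) = _); last first.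
  by rewrite /invmx uAt.
rewrite -[LHS](mulmxK uAt); congr (_ *m _).
rewrite AtE spectral_calcM -[RHS](spectral_calc_id _ Ap).
by apply: eq_spectral_calc => k; rewrite mulfVK.
Qed.

Lemma psdmx_conj m (A : 'M[C]_m) (Z : 'M[C]_(m, n)) :
  psdmx A -> psdmx (Z ^t* *m A *m Z).
Proof.
move=> [Ah Ap]; split.
  by rewrite !trmx_mul !map_mxM/= trmxCK Ah !mulmxA.
move=> x; have := Ap (Z *m x).
by rewrite trmx_mul map_mxM/= !mulmxA.
Qed.

Lemma psdmx_sum (m : nat) (F : 'I_m -> 'M[C]_n) :
  (forall k, psdmx (F k)) -> psdmx (\sum_(k < m) F k).
Proof.
move=> Fp; split.
  by rewrite raddf_sum/= raddf_sum/=; apply: eq_bigr => k _; exact: (Fp k).1.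
move=> x; rewrite mulmx_sumr mulmx_suml summxE.
by apply: sumr_ge0 => k _; exact: (Fp k).2.
Qed.

Lemma psdmx_diag d : (forall k, 0 <= d 0 k) -> psdmx (diag_mx d).
Proof.
move=> d0; split.
  rewrite tr_diag_mx map_diag_mx; congr diag_mx; apply/rowP => k.
  by rewrite mxE; apply: CrealP; exact: ger0_real.
move=> x; rewrite mxE; apply: sumr_ge0 => k _.
rewrite mul_mx_diag !mxE -mulrA mulrCA; apply: mulr_ge0 => //.
by rewrite mulrC -normCK exprn_ge0.
Qed.

End SpectralCalculus.

(** [spectralmx T] is unitary for every T, so the value is a unitary conjugate of a nonnegative
    diagonal matrix. *)
Lemma psdmx_spectral_calc {C : numClosedFieldType} {n} (f : C -> C) (T : 'M[C]_n) :
  (forall k, 0 <= f (spectral_diag T 0 k)) -> psdmx (spectral_calc f T).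
Proof.
move=> f0; rewrite /spectral_calc invmx_unitary ?spectral_unitarymx//.
by apply: psdmx_conj; apply: psdmx_diag => k; rewrite mxE.
Qed.

(** * Real eigenvalues and entries of the functional calculus *)

Section FunctionalCalculus.
Context {R : realType} {n : nat}.
Implicit Types (A T : 'M[R[i]]_n) (f g : R -> R).

Definition eigval T (k : 'I_n) : R := complex.Re (spectral_diag T 0 k).

Lemma funcalcE f T :
  funcalc f T = spectral_calc (fun z : R[i] => (f (complex.Re z))%:C) T.
Proof. by []. Qed.

Lemma eigval_ge0 A k : possemidef A -> 0 <= eigval A k.
Proof.
by move=> /(spectral_diag_ge0 A k); rewrite /eigval lecE => /andP[].
Qed.

Lemma spectral_diagE A k : possemidef A -> spectral_diag A 0 k = (eigval A k)%:C.
Proof.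
move=> /(spectral_diag_ge0 A k); rewrite /eigval lecE => /andP[/eqP/= i0 _].
by rewrite [LHS]complexE i0 mulr0 addr0.
Qed.

Lemma Re_weight_le1 T i j k : `|complex.Re (spectral_weight T i j k)| <= 1.
Proof. by rewrite -lecR (le_trans (normc_ge_Re _))// spectral_weight_le1. Qed.

Lemma Im_weight_le1 T i j k : `|complex.Im (spectral_weight T i j k)| <= 1.
Proof.
rewrite -lecR (le_trans _ (spectral_weight_le1 T i j k))//.
case: (spectral_weight T i j k) => a b; rewrite normc_def/= lecR.
by rewrite -sqrtr_sqr ler_wsqrtr// lerDr sqr_ge0.
Qed.

(** As f takes real values, the real part falls on the weights alone, and these are bounded by 1
    whatever T is. *)
Lemma Re_funcalc f T i j : complex.Re (funcalc f T i j) =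
  \sum_k f (eigval T k) * complex.Re (spectral_weight T i j k).
Proof.
rewrite funcalcE spectral_calcE.
rewrite (big_morph (@complex.Re R) (id1 := 0) (op1 := +%R)) => [|[? ?] []|]//.
apply: eq_bigr => k _; rewrite /eigval.
by case: (spectral_weight _ _ _ _) => a b /=; rewrite mul0r subr0.
Qed.

Lemma Im_funcalc f T i j : complex.Im (funcalc f T i j) =
  \sum_k f (eigval T k) * complex.Im (spectral_weight T i j k).
Proof.
rewrite funcalcE spectral_calcE.
rewrite (big_morph (@complex.Im R) (id1 := 0) (op1 := +%R)) => [|[? ?] []|]//.
apply: eq_bigr => k _; rewrite /eigval.
by case: (spectral_weight _ _ _ _) => a b /=; rewrite mul0r addr0.
Qed.

Lemma eigval_le_tr A k : possemidef A -> eigval A k <= complex.Re (\tr A).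
Proof.
move=> Ap; have := spectral_diag_le_tr A k Ap.
by rewrite /eigval lecE => /andP[].
Qed.

Lemma det_shift_eigval A (t : R) : possemidef A ->
  \det (A + t%:C%:M) = (\prod_k (eigval A k + t))%:C.
Proof.
move=> Ap; rewrite [LHS](det_shift A t%:C Ap) rmorph_prod.
by apply: eq_bigr => k _; rewrite spectral_diagE// rmorphD.
Qed.

(** The determinant is written as an embedded real number so that real and imaginary parts pass
    through the quotient. *)
Lemma funcalc_resolvent A (t : R) i j : possemidef A -> 0 < t ->
  funcalc (fun x => x / (x + t)) A i j =
    (A *m \adj (A + t%:C%:M)) i j * ((\prod_k (eigval A k + t))^-1)%:C.
Proof.
move=> Ap t0.
have t0' : 0 < t%:C by rewrite ltcR.
have E : funcalc (fun x => x / (x + t)) A = spectral_calc (fun x => x / (x + t%:C)) A.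
  rewrite funcalcE; apply: eq_spectral_calc => k.
  by rewrite spectral_diagE//= fmorph_div rmorphD.
have -> : ((\prod_k (eigval A k + t))^-1)%:C = (\det (A + t%:C%:M))^-1.
  by rewrite (det_shift_eigval A t Ap) (fmorphV (real_complex R)).
by rewrite E (spectral_calc_resolvent A t%:C Ap t0') mxE mulrC.
Qed.

Lemma possemidef_powmx T (p : R) : possemidef (powmx T p).
Proof. by apply: psdmx_spectral_calc => k; rewrite ler0c powR_ge0. Qed.

(** The eigenvectors of A do not depend on p; only the powers of its eigenvalues do. *)
Lemma cexppoly_mx_powmx A : possemidef A -> cexppoly_mx (fun p => powmx A p).
Proof.
move=> Ap i j.
apply: (@eq_cexppoly _
    (fun p => \sum_k ((eigval A k) `^ p)%:C * spectral_weight A i j k)).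
  by move=> p _; rewrite /powmx funcalcE spectral_calcE.
apply: cexppoly_sum => k; apply: cexppolyM; last exact: cexppoly_cst.
by apply/cexppoly_real/exppoly_powR/eigval_ge0.
Qed.

End FunctionalCalculus.

(** A is Hermitian, so the outer product is a conjugation by A. *)
Lemma possemidef_sandwich {R : realType} {n m : nat} (A : 'M[R[i]]_n)
    (B Z : 'I_m -> 'M[R[i]]_n) :
  possemidef A -> (forall k, possemidef (B k)) ->
  possemidef (A *m (\sum_(k < m) (Z k) ^t* *m B k *m Z k) *m A).
Proof.
move=> Ap Bp; rewrite -{1}[A]Ap.1; apply: psdmx_conj; apply: psdmx_sum => k.
exact/psdmx_conj/Bp.
Qed.

(** * Bounding the operator norm by the entries *)

Section OperatorNorm.
Context {R : realType} {n : nat}.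
Implicit Types (M : 'M[R[i]]_n) (x : 'cV[R[i]]_n).
Local Notation normc := ComplexField.Normc.normc.

Lemma normc_ge0 (z : R[i]) : 0 <= normc z.
Proof. by case: z => a b; exact: sqrtr_ge0. Qed.

Lemma normc_le_ReIm (z : R[i]) :
  normc z <= `|complex.Re z| + `|complex.Im z|.
Proof.
case: z => a b /=; rewrite -[leRHS]ger0_norm ?addr_ge0// -sqrtr_sqr.
rewrite ler_wsqrtr// sqrrD !real_normK ?num_real//.
by have := mulr_ge0 (normr_ge0 a) (normr_ge0 b); lra.
Qed.

Lemma normc_sum (I : Type) (r : seq I) (F : I -> R[i]) :
  normc (\sum_(i <- r) F i) <= \sum_(i <- r) normc (F i).
Proof.
elim: r => [|i r IH]; first by rewrite !big_nil ComplexField.Normc.normc0.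
rewrite !big_cons; apply: le_trans (le_normcD _ _) _; exact: lerD.
Qed.

Lemma l2norm_ge0 x : 0 <= l2norm x.
Proof. exact: sqrtr_ge0. Qed.

Lemma normc_le_l2norm x i : normc (x i 0) <= l2norm x.
Proof.
rewrite -[leLHS]ger0_norm ?normc_ge0// -sqrtr_sqr ler_wsqrtr//.
rewrite (bigD1 i)//= lerDl; apply: sumr_ge0 => k _; exact: sqr_ge0.
Qed.

(** After squaring, the right side has additional cross terms, all nonnegative. *)
Lemma l2norm_le_sum x : l2norm x <= \sum_i normc (x i 0).
Proof.
have s0 (r : seq 'I_n) : 0 <= \sum_(i <- r) normc (x i 0).
  by apply: sumr_ge0 => i _; exact: normc_ge0.
rewrite -[leRHS]ger0_norm// -sqrtr_sqr ler_wsqrtr//.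
elim: (index_enum _) => [|i r IH]; first by rewrite !big_nil expr0n.
rewrite !big_cons sqrrD -addrA lerD2l (le_trans IH)// lerDr.
by rewrite mulrn_wge0// mulr_ge0// normc_ge0.
Qed.

Lemma l2norm_mulmx_le M x : l2norm x <= 1 ->
  l2norm (M *m x) <= \sum_i \sum_j normc (M i j).
Proof.
move=> x1; apply: le_trans (l2norm_le_sum _) _; apply: ler_sum => i _.
rewrite mxE; apply: le_trans (normc_sum _ _ _) _; apply: ler_sum => j _.
rewrite ComplexField.Normc.normcM ler_piMr ?normc_ge0//.
exact: le_trans (normc_le_l2norm _ _) x1.
Qed.

Lemma l2norm0 : l2norm (0 : 'cV[R[i]]_n) = 0.
Proof.
rewrite /l2norm big1 ?sqrtr0// => i _.
by rewrite mxE ComplexField.Normc.normc0 expr0n.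
Qed.

Lemma opnorm_le_sum M : opnorm M <= \sum_i \sum_j normc (M i j).
Proof.
(* The zero vector shows that the set is non-empty, as the bound on [sup] requires. *)
apply: ge_sup.
  by exists (l2norm (M *m 0)), 0; rewrite //= l2norm0 ler01.
by move=> _ [x /= x1 <-]; exact: l2norm_mulmx_le.
Qed.

Lemma opnorm_ge0 M : 0 <= opnorm M.
Proof.
apply: (le_trans (l2norm_ge0 (M *m 0))); apply: ub_le_sup.
  by exists (\sum_i \sum_j normc (M i j)) => _ [x /= x1 <-]; exact: l2norm_mulmx_le.
by exists 0; rewrite //= l2norm0 ler01.
Qed.

End OperatorNorm.

(** * From convergence of resolvent sums to convergence of root sums *)

Section RootLimit.
Context {R : realType} {n : nat}.

(** Neither mu nor w is assumed to converge. The Riemann sum replaces the roots, uniformly in k, by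
    finitely many resolvent sums that do converge, so the root sum is Cauchy. *)
Lemma weighted_root_cvg (mu w : R -> 'I_n -> R) (B : R) :
  (forall p k, 1 <= p -> 0 <= mu p k) -> (forall p k, `|w p k| <= 1) ->
  (forall p k, 1 <= p -> mu p k `^ (1 / p) <= B) ->
  (forall s, 0 < s ->
    cvg (\sum_k mu p k / (mu p k + s `^ p) * w p k @[p --> +oo])) ->
  cvg (\sum_k mu p k `^ (1 / p) * w p k @[p --> +oo]).
Proof.
move=> mu0 w1 muB res; apply: cauchy_cvg; apply: cauchy_exP => e e0.
(* Chosen so that n errors of size 3d total at most e / 2; [n.+1] keeps the denominator non-zero
   when n = 0. *)
pose d := e / (2 * 3 * n.+1%:R).
have d0 : 0 < d by rewrite divr_gt0// mulr_gt0.
have nd : n%:R * (3 * d) <= e / 2.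
  have -> : e / 2 = n.+1%:R * (3 * d).
    rewrite /d; have : n.+1%:R != 0 :> R by rewrite pnatr_eq0.
    by move: n.+1%:R => c c0; field.
  by rewrite ler_pM2r ?ler_nat// mulr_gt0.
(* With N d >= B the grid covers every root. *)
pose N := (Num.truncn (B / d)).+1.
have BN : B <= N%:R * d.
  by rewrite -ler_pdivrMr// ltW// truncnS_gt.
pose g p := d * \sum_(j < N) \sum_k mu p k / (mu p k + (j.+1%:R * d) `^ p) * w p k.
have gc : cvg (g p @[p --> +oo]).
  apply: is_cvgZr; apply/cvg_ex; eexists.
  apply: cvg_big; first exact: add_continuous.
  by move=> j _; apply: res; rewrite mulr_gt0.
(* The Cauchy criterion wants, for each e, a centre whose e-ball eventually contains the values; the
   limit of g, which depends on e, serves. *)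
exists (lim (g p @[p --> +oo])).
have /cvgrPdist_lt /(_ (e / 2)) gl := gc.
have decay : expR (- N%:R^-1 * p) @[p --> +oo] --> (0 : R).
  by apply: cvgr_expR_neg; rewrite oppr_lt0 invr_gt0.
have /cvgrPdist_le /(_ N%:R^-1) decay' := decay.
change (\forall p \near +oo, `|lim (g x @[x --> +oo])
  - \sum_k mu p k `^ (1 / p) * w p k| < e).
near=> p.
have p1 : 1 <= p by near: p; exact: nbhs_pinfty_ge.
have p0 : 0 < p by apply: lt_le_trans p1.
rewrite (_ : _ - _ = (lim (g x @[x --> +oo]) - g p)
    + (g p - \sum_k mu p k `^ (1 / p) * w p k)); last by ring.
apply: (le_lt_trans (ler_normD _ _)).
rewrite [e](splitr e) ltr_leD//.
  by near: p; apply: gl; rewrite divr_gt0.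
apply: le_trans nd; rewrite /g exchange_big/= mulr_sumr -sumrB.
apply: (le_trans (ler_norm_sum _ _ _)).
have -> : n%:R * (3 * d) = \sum_(k < n) 3 * d.
  by rewrite sumr_const card_ord mulr_natl.
apply: ler_sum => k _.
rewrite -mulr_suml mulrA -mulrBl normrM -[leRHS]mulr1.
apply: ler_pM => //; rewrite distrC.
(* With x the p-th root of mu, each quotient takes the form x^p / (x^p + t^p) required by
   [powR_root_approx]. *)
have muE : mu p k = (mu p k `^ (1 / p)) `^ p.
  by rewrite -powRrM div1r mulVf ?gt_eqF// powRr1// mu0.
rewrite {2}muE; under eq_bigr do rewrite {2}muE.
apply: powR_root_approx => //.
- have : `|0 - expR (- N%:R^-1 * p)| <= N%:R^-1.
    by near: p; apply: decay'; rewrite invr_gt0.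
  by rewrite sub0r normrN ger0_norm ?expR_ge0.
- exact: powR_ge0.
- exact: le_trans (muB _ _ p1) BN.
Unshelve. all: by end_near. Qed.

End RootLimit.

(** * Roots of positive semidefinite families with exponential-sum entries *)

Section PowerMeanLimit.
Context {R : realType} {n : nat}.
Context (G : R -> 'M[R[i]]_n) (Gpsd : forall p, possemidef (G p)).
Context (Gexp : cexppoly_mx G).

(** Numerator and denominator of the resolvent G_p (G_p + s^p)^-1 in Cramer's rule; the shift s^p is
    itself an exponential in p. *)
Let num (s : R) p := G p *m \adj (G p + (s `^ p)%:C%:M).
Let den (s : R) p := \det (G p + (s `^ p)%:C%:M).

Let exp_shift s : 0 < s -> cexppoly_mx (fun p => G p + (s `^ p)%:C%:M).
Proof.
move=> s0; apply: cexppoly_mxD => // i j.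
apply: (@eq_cexppoly _ (fun p => (s `^ p)%:C * (i == j)%:R)) => [p _|].
  by rewrite mxE mulr_natr.
apply: cexppolyM; last exact: cexppoly_cst.
exact/cexppoly_real/exppoly_powR/ltW.
Qed.

(** [part] stands for the real or the imaginary part. It commutes with real scaling, so it turns the
    resolvent entry into a bounded quotient of real exponential sums. *)
Let resolvent_cvg (s : R) i j (part : R[i] -> R) : 0 < s ->
  (forall z r, part (z * r%:C) = part z * r) ->
  (forall p, `|part (funcalc (fun x => x / (x + s `^ p)) (G p) i j)| <= n%:R) ->
  exppoly (fun p => part (num s p i j)) ->
  cvg (part (funcalc (fun x => x / (x + s `^ p)) (G p) i j) @[p --> +oo]).
Proof.
move=> s0 partM part_le Enum.
have den_gt0 p : 0 < \prod_k (eigval (G p) k + s `^ p).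
  by apply: prodr_gt0 => k _; rewrite ltr_wpDl ?powR_gt0// eigval_ge0.
have E p : part (funcalc (fun x => x / (x + s `^ p)) (G p) i j) =
    part (num s p i j) / complex.Re (den s p).
  rewrite funcalc_resolvent ?powR_gt0// partM; congr (_ / _).
  by rewrite /den det_shift_eigval.
rewrite (_ : (fun p => _) = (fun p => part (num s p i j) / complex.Re (den s p))).
  apply: (@exppoly_ratio_cvg R (fun p => part (num s p i j))
    (fun p => complex.Re (den s p)) n%:R Enum) => [|p _|p _]; last by rewrite -E.
    exact: (cexppoly_det _ _ (exp_shift _ s0)).1.
  by rewrite /den det_shift_eigval//= gt_eqF.
by apply/funext => p; exact: E.
Qed.

Let exp_num s i j : 0 < s -> cexppoly (fun p => num s p i j).
Proof.
by move=> s0; apply: cexppoly_mulmx => //; apply: cexppoly_adj; exact: exp_shift.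
Qed.

(** Each of the n quotients lies between 0 and 1; this supplies the bound that [exppoly_ratio_cvg]
    needs. *)
Let weighted_le (w : 'I_n -> R) (s p : R) : 0 < s ->
  (forall k, `|w k| <= 1) ->
  `|\sum_k eigval (G p) k / (eigval (G p) k + s `^ p) * w k| <= n%:R.
Proof.
move=> s0 w1; apply: le_trans (ler_norm_sum _ _ _) _.
rewrite -[leRHS]mulr1 mulr_natl -[X in _ *+ X]card_ord -sumr_const.
apply: ler_sum => k _; rewrite normrM -[leRHS]mulr1.
have mu0 := eigval_ge0 (G p) k (Gpsd p).
apply: ler_pM => //; rewrite ger0_norm; last first.
  by rewrite divr_ge0// addr_ge0// powR_ge0.
by rewrite ler_pdivrMr ?ltr_wpDl ?powR_gt0// mul1r lerDl powR_ge0.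
Qed.

Let eigval_root_bounded :
  exists B : R, forall p k, 1 <= p -> eigval (G p) k `^ (1 / p) <= B.
Proof.
have Etr : cexppoly (fun p => \tr (G p)) by apply: cexppoly_sum => i; exact: Gexp.
have [C [t [C0 trC]]] := exppoly_bound _ Etr.1.
(* The p-th root of (C + 1) e^{t p} is (C + 1)^{1/p} e^t. Adding 1 makes the base at least 1, so its
   power 1/p <= 1 does not exceed it. *)
exists ((C + 1) * expR t) => p k p1.
have p0 : 0 < p by exact: lt_le_trans p1.
have muC : eigval (G p) k <= (C + 1) * expR (t * p).
  apply: le_trans (eigval_le_tr _ _ (Gpsd p)) _.
  apply: le_trans (ler_norm _) (le_trans (trC _ p0) _).
  by rewrite ler_wpM2r ?expR_ge0// lerDl.
have C1 : 0 <= C + 1 by rewrite addr_ge0.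
apply: (@le_trans _ _ (((C + 1) * expR (t * p)) `^ (1 / p))).
  apply: ge0_ler_powR => //; rewrite ?nnegrE ?eigval_ge0//.
  - by rewrite divr_ge0// ltW.
  - by rewrite mulr_ge0 ?expR_ge0.
rewrite powRM ?expR_ge0// -expRM -mulrA div1r mulfV ?gt_eqF// mulr1.
rewrite ler_wpM2r ?expR_ge0// ler1_powR ?lerDr//.
by rewrite invf_le1.
Qed.

(** The same weights w serve every f, which links the p-th root to the resolvents. *)
Let entry_cvg i j (part : R[i] -> R) (w : R -> 'I_n -> R) :
  (forall f p, part (funcalc f (G p) i j) = \sum_k f (eigval (G p) k) * w p k) ->
  (forall p k, `|w p k| <= 1) ->
  (forall z r, part (z * r%:C) = part z * r) ->
  (forall s, 0 < s -> exppoly (fun p => part (num s p i j))) ->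
  cvg (part (powmx (G p) (1 / p) i j) @[p --> +oo]).
Proof.
move=> partE w1 partM Enum; have [B muB] := eigval_root_bounded.
rewrite (_ : (fun p => _) = (fun p => \sum_k eigval (G p) k `^ (1 / p) * w p k)).
  apply: (weighted_root_cvg (fun p k => eigval (G p) k) w B) => // [p k _|s s0].
    exact: eigval_ge0.
  rewrite [X in cvg (X @ _)](_ : _ =
    (fun p => part (funcalc (fun x => x / (x + s `^ p)) (G p) i j))).
    apply: resolvent_cvg => // [p|]; last exact: Enum.
    by rewrite partE; exact: weighted_le.
  by apply/funext => p; rewrite partE.
by apply/funext => p; exact: partE.
Qed.

Lemma powmx_root_cvg :
  exists L, opnorm (powmx (G p) (1 / p) - L) @[p --> +oo] --> (0 : R).
Proof.
have reC i j : cvg (complex.Re (powmx (G p) (1 / p) i j) @[p --> +oo]).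
  apply: (entry_cvg i j (@complex.Re R)
    (fun p k => complex.Re (spectral_weight (G p) i j k))).
  - by move=> f p; exact: Re_funcalc.
  - by move=> p k; exact: Re_weight_le1.
  - by case=> a b r /=; rewrite mulr0 subr0.
  - by move=> s s0; exact: (exp_num s i j s0).1.
have imC i j : cvg (complex.Im (powmx (G p) (1 / p) i j) @[p --> +oo]).
  apply: (entry_cvg i j (@complex.Im R)
    (fun p k => complex.Im (spectral_weight (G p) i j k))).
  - by move=> f p; exact: Im_funcalc.
  - by move=> p k; exact: Im_weight_le1.
  - by case=> a b r /=; rewrite mulr0 add0r.
  - by move=> s s0; exact: (exp_num s i j s0).2.
(* The limit is assembled from the entrywise limits; the entrywise bound on [opnorm] then gives
   convergence in norm. *)
pose L : 'M[R[i]]_n := \matrix_(i, j)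
  (lim (complex.Re (powmx (G p) (1 / p) i j) @[p --> +oo]) +i*
   lim (complex.Im (powmx (G p) (1 / p) i j) @[p --> +oo])).
exists L.
pose bound p := \sum_i \sum_j
  (`|complex.Re (powmx (G p) (1 / p) i j) - complex.Re (L i j)| +
   `|complex.Im (powmx (G p) (1 / p) i j) - complex.Im (L i j)|).
have bound0 : bound p @[p --> +oo] --> (0 : R).
  rewrite (_ : 0 = \sum_(i < n) \sum_(j < n) (0 : R)); last first.
    by rewrite big1// => i _; rewrite big1.
  apply: cvg_big => [|i _]; first exact: add_continuous.
  apply: cvg_big => [|j _]; first exact: add_continuous.
  rewrite -[X in _ @ _ --> X](addr0 0); apply: cvgD.
    by apply/norm_cvg0P/subr_cvg0; rewrite mxE/=; exact: reC.
  by apply/norm_cvg0P/subr_cvg0; rewrite mxE/=; exact: imC.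
apply: (squeeze_cvgr _ (@cvg_cst _ _ _ _ _) bound0); near=> p.
rewrite opnorm_ge0/= (le_trans (opnorm_le_sum _))//.
apply: ler_sum => i _; apply: ler_sum => j _.
apply: le_trans (normc_le_ReIm _) _; rewrite mxE [(- L) i j]mxE.
by move: (powmx _ _ i j) (L i j) => [a b] [c d] /=.
Unshelve. all: by end_near. Qed.

End PowerMeanLimit.

Theorem theorem6p2 (R : realType) (n m : nat) (A : 'M[R[i]]_n)
    (B Z : 'I_m -> 'M[R[i]]_n)
    (hA : possemidef A) (hB : forall k : 'I_m, possemidef (B k)) :
  exists L : 'M[R[i]]_n,
    opnorm (powmx (powmx A p
                     *m (\sum_(k < m) (Z k) ^t* *m powmx (B k) p *m Z k)
                     *m powmx A p) (1 / p) - L) @[p --> +oo] --> (0 : R).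
Proof.
apply: powmx_root_cvg => [p|].
  by apply: possemidef_sandwich => [|k]; exact: possemidef_powmx.
(* The entries remain exponential sums because this class is closed under matrix sums and
   products. *)
apply: cexppoly_mulmx; last exact: cexppoly_mx_powmx.
apply: cexppoly_mulmx; first exact: cexppoly_mx_powmx.
apply: cexppoly_mx_sum => k; apply: cexppoly_mulmx; last exact: cexppoly_mx_cst.
by apply: cexppoly_mulmx; [exact: cexppoly_mx_cst|exact: cexppoly_mx_powmx].
Qed.
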